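(* Let $N\ge1$ and let $f=|0,\dots,N-1|$, $g=|0,\dots,N-2,N|$ be Casoratians of $\boldsymbol\psi$ (see context), as functions of $(n,m,\alpha,\beta)$. Then (GD-4 (C-3) bilinear form) $$(p-a)\widetilde f\dot{\check f}-(p-b)f\widetilde{\dot{\check f}}-(b-a)\dot f\widetilde{\check f}=0,\qquad (q-a)\widehat f\dot{\check f}-(q-b)f\widehat{\dot{\check f}}-(b-a)\dot f\widehat{\check f}=0,$$ $$f(a\widetilde{\check f}+\widetilde{\check g})+(p-a)\widetilde f\check f-(pf+g)\widetilde{\check f}=0,\qquad f(a\widehat{\check f}+\widehat{\check g})+(q-a)\widehat f\check f-(qf+g)\widehat{\check f}=0,$$ $$\widetilde f(p\dot f+\dot g)-(p-b)f\widetilde{\dot f}-(b\widetilde f+\widetilde g)\dot f=0,\qquad \widehat f(q\dot f+\dot g)-(q-b)f\widehat{\dot f}-(b\widehat f+\widehat g)\dot f=0,$$ $$(p-b)\widetilde{\dot f}\widehat f-(q-b)\widehat{\dot f}\widetilde f-(p-q)\widehat{\widetilde f}\dot f=0,$$ $$(a\check f+\check g)\widehat{\widetilde{\dot f}}-\check f(\widehat{\widetilde{\dot g}}-b\widehat{\widetilde{\dot f}})-\frac{p_b\,\widehat{\dot f}\widetilde{\check f}}{(p-q)(p-a)}+\frac{q_b\,\widetilde{\dot f}\widehat{\check f}}{(p-q)(q-a)}+(p+q-\alpha_3)\check f\widehat{\widetilde{\dot f}}-\frac{a_b}{(p-a)(q-a)}f\widehat{\widetilde{\dot{\check f}}}=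0.$$
   Context: Fix $\alpha_1,\alpha_2,\alpha_3\in\mathbb C$, $G(\omega,k)=\omega^4-k^4+\alpha_3(\omega^3-k^3)+\alpha_2(\omega^2-k^2)+\alpha_1(\omega-k)$. Let $p,q,a,b\in\mathbb C$ be pairwise distinct, $p_b=G(-p,-b)/(p-b)$, $q_b=G(-q,-b)/(q-b)$, $a_b=G(-a,-b)/(a-b)$. Fix $N\ge1$, $k_1,\dots,k_N\in\mathbb C$; for each $s$ let $\omega_1(k_s),\dots,\omega_4(k_s)$ be the four roots in $\omega$ of $G(-\omega,-k_s)=0$, with $\omega_4(k_s)=k_s$. For constants $\rho^{(0)}_{j,s}$ let $\psi_s(n,m,\alpha,\beta,l)=\sum_{j=1}^4\rho^{(0)}_{j,s}(-\omega_j(k_s))^l(p-\omega_j(k_s))^n(q-\omega_j(k_s))^m(a-\omega_j(k_s))^\alpha(b-\omega_j(k_s))^\beta$ and $\boldsymbol\psi(l)=(\psi_1,\dots,\psi_N)^T$. Casoratian notation: $|l_1,\dots,l_N|=\det(\boldsymbol\psi(l_1),\dots,\boldsymbol\psi(l_N))$; a run ''$0,\dots,j$'' with $j<0$ is empty. Shifts: $\widetilde F=F(n+1,m,\alpha,\beta)$, $\widehat F=F(n,m+1,\alpha,\beta)$, $\check F=F(n,m,\alpha-1,\beta)$, $\dot F=F(n,m,\alpha,\beta+1)$, composed as needed (e.g. $\widetilde{\dot{\check f}}=f(n+1,m,\alpha-1,\beta+1)$). *)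

(* Defs.v *)
From mathcomp Require Import all_boot all_algebra complex.
From mathcomp Require Import reals.
Set Implicit Arguments. Unset Strict Implicit. Unset Printing Implicit Defensive.
Import GRing.Theory Num.Theory.
Local Open Scope ring_scope.

Section Defs.
Variable C : pzRingType.

Definition Gdisp (a1 a2 a3 w k : C) : C :=
  w ^+ 4 - k ^+ 4 + a3 * (w ^+ 3 - k ^+ 3) + a2 * (w ^+ 2 - k ^+ 2) + a1 * (w - k).
End Defs.

Section Cas.
Variable C : unitRingType.
Variable N : nat.

(* psi_s(n,m,al,be,l) = sum_{j<4} rho_{j,s} (-om_j)^l (p-om_j)^n (q-om_j)^m (a-om_j)^al (b-om_j)^be,
   om s j = omega_{j+1}(k_s), rho s j = rho^{(0)}_{j+1,s}; n m al be are integers. *)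
Definition psi (rho om : 'I_N -> 'I_4 -> C) (p q a b : C)
  (s : 'I_N) (n m al be : int) (l : nat) : C :=
  \sum_(j < 4) rho s j * (- om s j) ^+ l * (p - om s j) ^ n * (q - om s j) ^ m
                 * (a - om s j) ^ al * (b - om s j) ^ be.
End Cas.

Section Det.
Variable C : comUnitRingType.
Variable N : nat.

Definition casoratian (rho om : 'I_N -> 'I_4 -> C) (p q a b : C)
  (cols : 'I_N -> nat) (n m al be : int) : C :=
  \det (\matrix_(s < N, k < N) psi rho om p q a b s n m al be (cols k)).

Definition cols_f (k : 'I_N) : nat := k.
Definition cols_g (k : 'I_N) : nat := if k.+1 == N then N else k.
End Det.

(* Main.v *)
Require Import Defs.
From HB Require Import structures.
From mathcomp Require Import all_boot all_algebra complex.
From mathcomp Require Import reals.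
From mathcomp Require Import ring zify.
Import GRing.Theory Num.Theory.
Local Open Scope ring_scope.

(** Fix the base point (n, m, al, be).  The entries psi_s are linear functionals L_s on
    polynomials in y, evaluated at the nodes y = - omega_j(k_s), and each shift multiplies the
    argument by a linear factor; so f and g become the determinants D(B) of L_s(B y^k),
    k < N, and Dg(B), where the last column is L_s(B y^N).

    Expanding the N x (N+1) array L_s(A y^k) along the missing row produces the polynomial X_A
    of degree N with L_s(A X_A) = 0 for all s; its two top coefficients are D(A) and - Dg(A),
    and its value at x is D(A (y - x)) up to sign.  Dually, for E = prod_i (y - x_i), the
    cofactors of the last column of D(E) combine the L_s into a functional M that kills E y^k
    for k < N - 1, takes the values D(E), Dg(E) at E y^(N-1), E y^N, and the value
    D(E / (y - x_i)) up to sign at E / (y - x_i).  If L_s(F P) = h_s L_s(A P) for all s, then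
    M(F X_A) = 0, and reducing F X_A modulo E by Lagrange interpolation turns this into a
    bilinear identity.  Three nodes with A = F = 1, or one node with A = F linear, give the
    first seven equations.  The last one comes from the nodes -p, -q, -a, -b with A = 1 and
    F = G(y, -b): as G(-omega_j, -k_s) = 0, L_s(F P) = G(-k_s, -b) L_s(P). *)

(** * Polynomial coefficients, column operations and interpolation *)

Lemma coefM_top (C : nzRingType) (p q : {poly C}) (m n : nat) :
  (size p <= m.+1)%N -> (size q <= n.+1)%N -> (p * q)`_(m + n) = p`_m * q`_n.
Proof.
move=> sp sq; have lt_m : (m < (m + n).+1)%N by rewrite ltnS leq_addr.
rewrite coefM (bigD1 (Ordinal lt_m)) //= big1 ?addr0 ?addKn // => i neq_im.
have {}neq_im : (i : nat) <> m by move=> e; case/eqP: neq_im; apply: val_inj.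
have [lt_mi|le_im] := ltnP m i.
  by rewrite [p`_i]nth_default ?mul0r // (leq_trans sp).
by rewrite [q`__]nth_default ?mulr0 // (leq_trans sq); lia.
Qed.

Lemma coefM_next (C : nzRingType) (p q : {poly C}) (m n : nat) :
  (size p <= m.+2)%N -> (size q <= n.+2)%N ->
  (p * q)`_(m + n).+1 = p`_m.+1 * q`_n + p`_m * q`_n.+1.
Proof.
move=> sp sq; have lt_m : (m < (m + n).+2)%N by rewrite ltnS leqW ?leq_addr.
have lt_m1 : (m.+1 < (m + n).+2)%N by rewrite !ltnS leq_addr.
rewrite coefM (bigD1 (Ordinal lt_m1)) //= (bigD1 (Ordinal lt_m)) /=; last first.
  by rewrite -val_eqE /= neq_ltn ltnSn.
have -> : ((m + n).+1 - m)%N = n.+1 by lia.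
rewrite subSS addKn big1 ?addr0 // => i /andP[neq1 neq2].
have {}neq1 : (i : nat) <> m.+1 by move=> e; case/eqP: neq1; apply: val_inj.
have {}neq2 : (i : nat) <> m by move=> e; case/eqP: neq2; apply: val_inj.
have [lt_mi|le_im] := ltnP m i.
  by rewrite [p`_i]nth_default ?mul0r // (leq_trans sp) //; lia.
by rewrite [q`__]nth_default ?mulr0 // (leq_trans sq) //; lia.
Qed.

(** All the column operations at once amount to right multiplication by a unit upper triangular
    matrix. They serve to turn the columns [y^k] into [(y - u) y^(k-1)], leaving the first one
    alone. *)
Lemma det_col_shift (C : comNzRingType) (n : nat) (v : 'I_n.+1 -> nat -> C) (u : C) :
  \det (\matrix_(i, j < n.+1)
      if (j : nat) is j'.+1 then v i j'.+1 - u * v i j' else v i 0) =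
  \det (\matrix_(i, j < n.+1) v i j).
Proof.
pose U : 'M[C]_n.+1 := \matrix_(i, j) ((i == j)%:R - u * (i.+1 == j)%:R).
have -> : \matrix_(i, j < n.+1)
      (if (j : nat) is j'.+1 then v i j'.+1 - u * v i j' else v i 0) =
    (\matrix_(i, j < n.+1) v i j) *m U.
  apply/matrixP=> i j; rewrite !mxE.
  under eq_bigr => k _ do rewrite !mxE mulrBr.
  rewrite sumrB (bigD1 j) //= eqxx mulr1 big1 ?addr0; last first.
    by move=> k /negbTE ->; rewrite mulr0.
  case: j => [[|j] lt_j] /=.
    by rewrite big1 ?subr0 // => k _; rewrite !mulr0.
  rewrite (bigD1 (Ordinal (ltnW lt_j))) //= eqxx big1 ?addr0; first by rewrite mulr1 mulrC.
  move=> k /eqP neq_kj; case: eqP => [[e]|_]; last by rewrite !mulr0.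
  by case: neq_kj; apply: val_inj.
rewrite det_mulmx -[\det U]det_tr (@det_trig _ _ U^T); last first.
  apply/is_trig_mxP=> i j lt_ij; rewrite !mxE.
  have -> : (j == i) = false by apply/negbTE; rewrite -val_eqE neq_ltn lt_ij orbT.
  by have -> : (j.+1 == i) = false; [lia | rewrite mulr0 subr0].
rewrite big1 ?mulr1 // => i _; rewrite !mxE eqxx.
by have -> : (i.+1 == i) = false; [lia | rewrite mulr0 subr0].
Qed.

(** The difference of the two sides has size at most [r] and [r] distinct roots. *)
Lemma lagrange_interpolation (C : fieldType) (r : nat) (x : 'I_r -> C) (R : {poly C}) :
  injective x -> (size R <= r)%N ->
  R = \sum_i (R.[x i] / \prod_(j | j != i) (x i - x j)) *:
        \prod_(j | j != i) ('X - (x j)%:P).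
Proof.
move=> x_inj szR; apply/eqP; rewrite -subr_eq0; apply/eqP.
apply: (@roots_geq_poly_eq0 _ _ [seq x i | i <- enum 'I_r]).
- apply/allP=> _ /mapP[i _ ->]; rewrite rootE hornerD hornerN subr_eq0 horner_sum.
  rewrite (bigD1 i) //= [X in _ + X]big1 ?addr0; last first.
    move=> k neq_ki; rewrite hornerZ horner_prod [X in _ * X](bigD1 i) 1?eq_sym //=.
    by rewrite hornerXsubC subrr mul0r mulr0.
  rewrite hornerZ horner_prod; under [X in _ * X]eq_bigr => j _ do rewrite hornerXsubC.
  rewrite divfK //; apply/prodf_neq0 => j neq_ji.
  by rewrite subr_eq0 (inj_eq x_inj) eq_sym.
- by rewrite map_inj_uniq ?enum_uniq.
- rewrite size_map size_enum_ord (leq_trans (size_polyD _ _)) // geq_max szR size_polyN.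
  apply: leq_trans (size_sum _ _ _) _; apply/bigmax_leqP=> i _.
  apply: leq_trans (size_scale_leq _ _) _.
  have := size_prod_XsubC (index_enum 'I_r) x; rewrite (bigD1 i) //=.
  rewrite size_monicM ?monicXsubC ?monic_neq0 ?monic_prod_XsubC // size_XsubC.
  have -> : size (index_enum 'I_r) = r by rewrite -[index_enum _]enumT size_enum_ord.
  by rewrite add2n /= => -[->].
Qed.

Lemma nth0_inj (C : nzRingType) (s : seq C) (r : nat) :
  size s = r -> uniq s -> injective (fun i : 'I_r => s`_i).
Proof.
move=> szs s_uniq i j /eqP; rewrite nth_uniq ?szs ?ltn_ord // => /eqP ij.
exact: val_inj.
Qed.

(** * Bilinear identities for determinants of a family of linear functionals *)

Section Bilinear.
Context {C : fieldType} {n : nat} (L : 'I_n.+1 -> {scalar {poly C}}).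

Definition polydet (cols : 'I_n.+1 -> nat) (B : {poly C}) : C :=
  \det (\matrix_(s, k) L s (B * 'X^(cols k))).

Local Notation D := (polydet (@cols_f n.+1)).
Local Notation Dg := (polydet (@cols_g n.+1)).

(** The [X_A] of the overview: signed maximal minors, where [bump k] skips column [k]. *)
Definition orthpoly (A : {poly C}) : {poly C} :=
  \poly_(k < n.+2) ((-1) ^+ (n.+1 + k)
     * \det (\matrix_(s < n.+1, j < n.+1) L s (A * 'X^(bump k j)))).

Lemma orthpoly_lead A : (orthpoly A)`_n.+1 = D A.
Proof.
rewrite coef_poly ltnSn -signr_odd oddD addbb mul1r; congr (\det _).
by apply/matrixP=> s j; rewrite !mxE /bump leqNgt ltn_ord.
Qed.

Lemma orthpoly_next A : (orthpoly A)`_n = - Dg A.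
Proof.
rewrite coef_poly ltnW // -signr_odd oddD addNb addbb mulN1r; congr (- \det _).
apply/matrixP=> s j; rewrite !mxE /bump /cols_g eqSS eq_sym.
have := ltn_ord j; rewrite ltnS leq_eqVlt eq_sym => /orP[/eqP <-|lt_jn].
  by rewrite leqnn eqxx.
by rewrite leqNgt lt_jn gtn_eqF.
Qed.

(** The missing row is filled with the powers of [x], placed last; its cofactors do not involve
    [x]. *)
Definition bordered A (x : C) : 'M[C]_n.+2 :=
  \matrix_(i, k) if unlift ord_max i is Some s then L s (A * 'X^k) else x ^+ k.

Lemma orthpolyE A x :
  orthpoly A = \sum_(k < n.+2) cofactor (bordered A x) ord_max k *: 'X^k.
Proof.
rewrite /orthpoly poly_def; apply: eq_bigr => k _; congr (_ * \det _ *: _).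
by apply/matrixP=> s j; rewrite !mxE liftK.
Qed.

Lemma orthpoly_orth A s : L s (A * orthpoly A) = 0.
Proof.
(* The value 0 is arbitrary. Row [s] paired with the cofactors of the last row is an off-diagonal
   entry of [M *m \adj M], hence zero. *)
rewrite (orthpolyE A 0) mulr_sumr raddf_sum /=.
have := congr1 (fun M : 'M_n.+2 => M (lift ord_max s) ord_max) (mul_mx_adj (bordered A 0)).
rewrite !mxE -val_eqE /= /bump leqNgt ltn_ord add0n ltn_eqF // mulr0n => e.
rewrite -[RHS]e; apply: eq_bigr => k _.
by rewrite !mxE liftK -scalerAr linearZ /= mulrC.
Qed.

(** The value is the determinant of [bordered A x]. Subtracting [x] times the preceding column from
    each column turns the last row into (1, 0, ..., 0) and puts the factor [y - x] into the
    remaining minor. *)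
Lemma horner_orthpoly A x :
  (orthpoly A).[x] = (-1) ^+ n.+1 * D (A * ('X - x%:P)).
Proof.
rewrite (orthpolyE A x) horner_sum.
transitivity (\det (bordered A x)).
  rewrite (expand_det_row _ ord_max); apply: eq_bigr => k _.
  by rewrite !mxE unlift_none hornerZ hornerXn mulrC.
rewrite -(det_col_shift _ _ (fun i k =>
   if unlift ord_max i is Some s then L s (A * 'X^k) else x ^+ k) x).
rewrite (expand_det_row _ ord_max) big_ord_recl big1 ?addr0 /=; last first.
  by move=> k _; rewrite !mxE /= unlift_none exprS subrr mul0r.
rewrite !mxE /= unlift_none mul1r /cofactor addn0; congr (_ * \det _).
apply/matrixP=> s j; rewrite !mxE /= liftK.
rewrite -[x * _]/(x *: (_ : C^o)) -linearZ -linearB /=; congr (L s _).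
by rewrite -mul_polyC exprS; ring.
Qed.

(** The [M] of the overview: the determinant for [E] with its last column replaced by the values
    [L s P]. *)
Definition cofunctional (E P : {poly C}) : C :=
  \sum_s cofactor (\matrix_(s, k < n.+1) L s (E * 'X^k)) s ord_max * L s P.

Fact cofunctional_is_scalar E : scalar (cofunctional E).
Proof.
move=> c P Q; rewrite mulr_sumr -big_split /=; apply: eq_bigr => s _.
by rewrite linearP /=; ring.
Qed.
HB.instance Definition _ E :=
  GRing.isLinear.Build C {poly C} C _ (cofunctional E) (cofunctional_is_scalar E).

Lemma cofunctional_low E (k : nat) : (k < n)%N -> cofunctional E (E * 'X^k) = 0.
Proof.
move=> lt_kn; pose M := \matrix_(s, k < n.+1) L s (E * 'X^k).
have := congr1 (fun M : 'M_n.+1 => M ord_max (inord k)) (mul_adj_mx M).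
rewrite !mxE -val_eqE /= inordK ?ltnS ?(ltnW lt_kn) // gtn_eqF // mulr0n => e.
rewrite -[RHS]e; apply: eq_bigr => s _.
by rewrite !mxE inordK ?ltnS ?(ltnW lt_kn).
Qed.

Lemma cofunctional_last E : cofunctional E (E * 'X^n) = D E.
Proof.
rewrite /polydet (expand_det_col _ ord_max); apply: eq_bigr => s _.
by rewrite !mxE mulrC.
Qed.

Lemma cofunctional_next E : cofunctional E (E * 'X^(n.+1)) = Dg E.
Proof.
rewrite /polydet (expand_det_col _ ord_max); apply: eq_bigr => s _.
rewrite !mxE /cols_g eqxx mulrC; congr (_ * (_ * \det _)).
apply/matrixP=> i j; rewrite !mxE /= /bump leqNgt ltn_ord add0n eqSS.
by rewrite ltn_eqF.
Qed.

(** After the column shift by [x], columns 1 to [n] of the array for [E1] are columns 0 to [n - 1]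
    of the array for [E1 * (y - x)]. Both sides thus use the same minors, the distinguished column
    being first in one and last in the other, whence the sign. *)
Lemma cofunctional_divXsub E1 x :
  cofunctional (E1 * ('X - x%:P)) E1 = (-1) ^+ n * D E1.
Proof.
rewrite /polydet.
rewrite -[\det _](det_col_shift _ _ (fun s k => L s (E1 * 'X^k)) x).
rewrite (expand_det_col _ 0) mulr_sumr; apply: eq_bigr => s _.
rewrite !mxE expr0 mulr1 /cofactor addn0 exprD.
rewrite mulrC [RHS]mulrCA [X in _ = _ * X]mulrA [(-1) ^+ n * (-1) ^+ s]mulrC.
congr (_ * (_ * \det _)).
apply/matrixP=> i j; rewrite !mxE /= /bump leqNgt ltn_ord add0n.
rewrite -[x * _]/(x *: (_ : C^o)) -linearZ -linearB /=; congr (L _ _).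
by rewrite -mul_polyC exprS; ring.
Qed.


(** Divide [P] by [E]: of the quotient only the two top coefficients survive, and the remainder is
    interpolated at the nodes. *)
Lemma cofunctional_interp (r : nat) (x : 'I_r.+1 -> C) (P : {poly C}) :
  injective x -> (size P <= (n + r).+3)%N ->
  let E := \prod_i ('X - (x i)%:P) in
  cofunctional E P =
    P`_(n + r).+2 * Dg E + (P`_(n + r).+1 + (\sum_i x i) * P`_(n + r).+2) * D E
    + (-1) ^+ n * \sum_i P.[x i] * D (\prod_(j | j != i) ('X - (x j)%:P))
                   / \prod_(j | j != i) (x i - x j).
Proof.
move=> x_inj szP E; set Q := P %/ E; set R := P %% E.
have monE : E \is monic by apply: monic_prod_XsubC.
have szE : size E = r.+2.
  by rewrite /E size_prod_XsubC -[index_enum _]enumT size_enum_ord.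
have szQ : (size Q <= n.+2)%N by rewrite size_divp ?monic_neq0 // szE /= leq_subLR (leq_trans szP) //; lia.
have szR : (size R <= r.+1)%N by have := ltn_modpN0 P (monic_neq0 monE); rewrite szE.
have defP : P = E * Q + R by rewrite mulrC -divp_eq.
have E_lead : E`_r.+1 = 1 by move/monicP: monE; rewrite lead_coefE szE.
have E_next : E`_r = - \sum_i x i.
  have := @coefPn_prod_XsubC C [seq x i | i <- index_enum 'I_r.+1].
  have -> : size [seq x i | i <- index_enum 'I_r.+1] = r.+1.
    by rewrite size_map -[index_enum _]enumT size_enum_ord.
  by rewrite !big_map => ->.
have coefP2 : P`_(n + r).+2 = Q`_n.+1.
  rewrite defP coefD [R`_ _]nth_default ?addr0; last by apply: leq_trans szR _; lia.
  by rewrite addnC -addSn -addnS coefM_top ?szE // E_lead mul1r.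
have coefP1 : P`_(n + r).+1 = Q`_n - (\sum_i x i) * Q`_n.+1.
  rewrite defP coefD [R`_ _]nth_default ?addr0; last by apply: leq_trans szR _; lia.
  by rewrite addnC coefM_next ?szE // E_lead E_next mul1r mulNr.
have horP i : P.[x i] = R.[x i].
  by rewrite defP hornerD hornerM horner_prod (bigD1 i) //= hornerXsubC subrr !mul0r add0r.
rewrite coefP1 coefP2 subrK.
rewrite {1}defP raddfD /=; congr (_ + _).
  (* The quotient is padded to exactly [n.+2] terms so that its two top terms can be split off. *)
  rewrite -[in LHS](coefK Q) (_ : \poly_(i < size Q) Q`_i = \poly_(i < n.+2) Q`_i); last first.
    apply/polyP=> i; rewrite !coef_poly; case: ifP => [lt_i|ge_i].
      by rewrite (leq_trans lt_i).
    by case: ifP => // _; rewrite nth_default // leqNgt ge_i.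
  rewrite poly_def mulr_sumr raddf_sum /= 2!big_ord_recr big1 /=; last first.
    by move=> i _; rewrite -scalerAr linearZ /= cofunctional_low ?mulr0.
  rewrite -!scalerAr !linearZ /= cofunctional_last cofunctional_next.
  by rewrite add0r addrC.
rewrite {1}(lagrange_interpolation _ _ _ _ x_inj szR) linear_sum mulr_sumr; apply: eq_bigr => i _.
rewrite linearZ /= horP /E [X in cofunctional X](bigD1 i) //=.
rewrite [X in cofunctional X]mulrC cofunctional_divXsub.
ring.
Qed.

(** The hypothesis on [F] gives [L s (F * orthpoly A) = h s * L s (A * orthpoly A) = 0], so
    [cofunctional E] vanishes at [F * orthpoly A]; [cofunctional_interp] evaluates it a second
    time. *)
Lemma bilinear_identity (r : nat) (x : 'I_r.+1 -> C) (A F : {poly C}) (h : 'I_n.+1 -> C) :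
  injective x -> (size F <= r.+2)%N ->
  (forall s P, L s (F * P) = h s * L s (A * P)) ->
  let E := \prod_i ('X - (x i)%:P) in
  F`_r.+1 * (D A * Dg E - Dg A * D E) + (F`_r + (\sum_i x i) * F`_r.+1) * D A * D E
  = \sum_i F.[x i] * D (A * ('X - (x i)%:P)) * D (\prod_(j | j != i) ('X - (x j)%:P))
           / \prod_(j | j != i) (x i - x j).
Proof.
move=> x_inj szF LF E.
have szX : (size (orthpoly A) <= n.+2)%N by apply: size_poly.
have : cofunctional E (F * orthpoly A) = 0.
  by rewrite /cofunctional big1 // => s _; rewrite LF orthpoly_orth !mulr0.
rewrite cofunctional_interp //; last by apply: leq_trans (size_polyMleq _ _) _; lia.
have -> : (F * orthpoly A)`_(n + r).+2 = F`_r.+1 * D A.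
  by rewrite addnC -addSn -addnS coefM_top // orthpoly_lead.
have -> : (F * orthpoly A)`_(n + r).+1 = F`_r * D A - F`_r.+1 * Dg A.
  by rewrite addnC coefM_next // orthpoly_lead orthpoly_next mulrN addrC.
have -> : \sum_i (F * orthpoly A).[x i] * D (\prod_(j | j != i) ('X - (x j)%:P))
                 / \prod_(j | j != i) (x i - x j)
  = (-1) ^+ n.+1 * \sum_i F.[x i] * D (A * ('X - (x i)%:P))
      * D (\prod_(j | j != i) ('X - (x j)%:P)) / \prod_(j | j != i) (x i - x j).
  rewrite [RHS]mulr_sumr; apply: eq_bigr => i _.
  by rewrite hornerM horner_orthpoly; ring.
rewrite -/E mulrA -exprD addnS exprS -signr_odd oddD addbb mulr1 mulN1r.
move=> /eqP; rewrite subr_eq0 => /eqP <-; ring.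
Qed.


Lemma one_node_identity (u v : C) :
  D ('X - v%:P) * Dg ('X - u%:P) - Dg ('X - v%:P) * D ('X - u%:P)
    + (u - v) * D ('X - v%:P) * D ('X - u%:P)
  = (u - v) * D (('X - u%:P) * ('X - v%:P)) * D 1.
Proof.
have u_inj : injective (fun _ : 'I_1 => u) by move=> i j _; rewrite !ord1.
have := bilinear_identity 0 (fun=> u) ('X - v%:P) ('X - v%:P) (fun=> 1) u_inj.
rewrite size_XsubC => /(_ isT (fun s P => esym (mul1r _))).
move: D Dg => d dg; rewrite !big_ord_recl !big_ord0 /=.
do 2!rewrite big_mkcond !big_ord_recl !big_ord0 /=.
rewrite !mulr1 !hornerXsubC !coefB !coefX !coefC /= divr1 !addr0.
by rewrite [('X - u%:P) * _]mulrC => <-; ring.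
Qed.

Lemma three_node_identity (u v w : C) : uniq [:: u; v; w] ->
  (u - v) * D (('X - u%:P) * ('X - v%:P)) * D ('X - w%:P)
  + (v - w) * D (('X - v%:P) * ('X - w%:P)) * D ('X - u%:P)
  + (w - u) * D (('X - u%:P) * ('X - w%:P)) * D ('X - v%:P) = 0.
Proof.
move=> uvw; have := bilinear_identity 2 (fun i => [:: u; v; w]`_i) 1 1 (fun=> 1).
move=> /(_ (nth0_inj _ [:: u; v; w] 3 erefl uvw)).
rewrite size_poly1 => /(_ isT (fun s P => esym (mul1r _))).
move: D Dg => d dg; rewrite !coef1 /= !(mul0r, mulr0, addr0).
rewrite !big_ord_recl !big_ord0 /=.
do 6!rewrite big_mkcond !big_ord_recl !big_ord0 /=.
rewrite /= !mul1r !mulr1 !hornerC.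
move: uvw; rewrite /= !inE negb_or andbT -(subr_eq0 u v) -(subr_eq0 u w) -(subr_eq0 v w).
move=> /andP[/andP[uv uw] vw] /esym e.
(* The left side of the bilinear identity is zero as [F = 1] has no coefficients in degrees 2 and 3;
   the Vandermonde product clears the denominators. *)
transitivity ((u - v) * (u - w) * (v - w) * 0); last by rewrite mulr0.
rewrite -{}e; field.
by rewrite -(opprB v w) -(opprB u w) -(opprB u v) !oppr_eq0 vw uw uv.
Qed.

Lemma four_node_identity (p q a b : C) (F : {poly C}) (h : 'I_n.+1 -> C) :
  uniq [:: p; q; a; b] -> (size F <= 5)%N ->
  (forall s P, L s (F * P) = h s * L s P) ->
  let X u : {poly C} := 'X - u%:P in
  F`_4 * (D 1 * Dg (X p * X q * X a * X b) - Dg 1 * D (X p * X q * X a * X b))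
   + (F`_3 + (p + q + a + b) * F`_4) * D 1 * D (X p * X q * X a * X b)
  = F.[p] * D (X p) * D (X q * X a * X b) / ((p - q) * (p - a) * (p - b))
  + F.[q] * D (X q) * D (X p * X a * X b) / ((q - p) * (q - a) * (q - b))
  + F.[a] * D (X a) * D (X p * X q * X b) / ((a - p) * (a - q) * (a - b))
  + F.[b] * D (X b) * D (X p * X q * X a) / ((b - p) * (b - q) * (b - a)).
Proof.
move=> pqab szF LF X.
have LF1 s P : L s (F * P) = h s * L s (1 * P) by rewrite LF mul1r.
have := bilinear_identity 3 (fun i => [:: p; q; a; b]`_i) 1 F h
  (nth0_inj _ [:: p; q; a; b] 4 erefl pqab) szF LF1.
move: D Dg => d dg; rewrite !big_ord_recl !big_ord0 /=.
do 8!rewrite big_mkcond !big_ord_recl !big_ord0 /=.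
by rewrite /= !mul1r !mulr1 !mulrA !addr0 !addrA.
Qed.

End Bilinear.

(** * Casoratians as determinants of weighted evaluation functionals *)

Section EvalSum.
Context {C : fieldType} {r : nat} (w y : 'I_r -> C).

Definition evalsum (P : {poly C}) : C := \sum_j w j * P.[y j].

Fact evalsum_is_scalar : scalar evalsum.
Proof.
move=> c P Q; rewrite mulr_sumr -big_split /=; apply: eq_bigr => j _.
by rewrite hornerD hornerZ; ring.
Qed.
HB.instance Definition _ :=
  GRing.isLinear.Build C {poly C} C _ evalsum evalsum_is_scalar.

End EvalSum.

Section Casoratian.
Context {C : fieldType} {N : nat} (rho om : 'I_N -> 'I_4 -> C) (p q a b : C).

Definition weight (n m al be : int) (s : 'I_N) (j : 'I_4) : C :=
  rho s j * (p - om s j) ^ n * (q - om s j) ^ m * (a - om s j) ^ al * (b - om s j) ^ be.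

Definition psifun (n m al be : int) (s : 'I_N) : {scalar {poly C}} :=
  evalsum (weight n m al be s) (fun j => - om s j).

Hypothesis om_neq : forall s j, [/\ p != om s j, q != om s j, a != om s j & b != om s j].

(** Raising an exponent by one multiplies a summand by [p - om s j], which is [y - (- p)] at the
    node [y = - om s j]. Nonzero bases let integer exponents add. *)
Lemma psi_shift (n m al be : int) (i j k l c : nat) s :
  psi rho om p q a b s (n + i%:Z) (m + j%:Z) (al + k%:Z) (be + l%:Z) c
  = psifun n m al be s (('X - (- p)%:P) ^+ i * ('X - (- q)%:P) ^+ j
      * ('X - (- a)%:P) ^+ k * ('X - (- b)%:P) ^+ l * 'X^c).
Proof.
rewrite /psi /psifun /evalsum /=; apply: eq_bigr => h _.
have [np nq na nb] := om_neq s h.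
rewrite !expfzDr ?subr_eq0 // !hornerM !horner_exp !hornerXsubC hornerX /weight !opprK.
by rewrite -!exprnP !(addrC (- om s h)); ring.
Qed.

End Casoratian.

(** Boolean flags suffice since each variable is shifted by 0 or 1 from a suitable base point. *)
Lemma casoratian_shift (C : fieldType) (N : nat) (rho om : 'I_N.+1 -> 'I_4 -> C)
    (p q a b : C) (n m al be : int) (i j k l : bool) (cols : 'I_N.+1 -> nat) :
  (forall s j, [/\ p != om s j, q != om s j, a != om s j & b != om s j]) ->
  casoratian rho om p q a b cols (if i then n + 1 else n) (if j then m + 1 else m)
    (if k then al + 1 else al) (if l then be + 1 else be)
  = polydet (psifun rho om p q a b n m al be) cols
      ((if i then 'X - (- p)%:P else 1) * (if j then 'X - (- q)%:P else 1)
       * (if k then 'X - (- a)%:P else 1) * (if l then 'X - (- b)%:P else 1)).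
Proof.
move=> om_neq; congr (\det _); apply/matrixP=> s c; rewrite !mxE.
have ifXn (e : bool) (P : {poly C}) : (if e then P else 1) = P ^+ e by case: e.
have ifD1 (e : bool) (z : int) : (if e then z + 1 else z) = z + e%:Z.
  by case: e; rewrite ?addr0.
by rewrite !ifXn !ifD1 psi_shift.
Qed.

(** [Gdisp] is a difference of values of one polynomial, so G(x, -b) = G(x, -k_s) + G(-k_s, -b), and
    the first term vanishes at every node. *)
Lemma psifun_dispersion (C : fieldType) (N : nat) (rho om : 'I_N -> 'I_4 -> C)
    (p q a b : C) (n m al be : int) (al1 al2 al3 : C) (k : 'I_N -> C) (F : {poly C}) :
  (forall x, F.[x] = Gdisp al1 al2 al3 x (- b)) ->
  (forall s j, Gdisp al1 al2 al3 (- om s j) (- k s) = 0) ->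
  forall s P, psifun rho om p q a b n m al be s (F * P)
    = Gdisp al1 al2 al3 (- k s) (- b) * psifun rho om p q a b n m al be s P.
Proof.
move=> FE Gom s P; rewrite /psifun /= /evalsum mulr_sumr; apply: eq_bigr => j _.
rewrite hornerM FE mulrCA; congr (_ * _).
by rewrite -[RHS]add0r -(Gom s j) /Gdisp; ring.
Qed.

(** * The eight equations read off from the one-, three- and four-node identities *)

Theorem theorem5p1 (R : realType) (al1 al2 al3 p q a b : R[i]) (N : nat)
  (k : 'I_N -> R[i]) (om rho : 'I_N -> 'I_4 -> R[i]) :
  (0 < N)%N ->
  p != q -> p != a -> p != b -> q != a -> q != b -> a != b ->
  (* om s 0..3 are the four roots (with multiplicity) of G(-w,-k_s) = 0 in w *)
  (forall (s : 'I_N) (x : R[i]),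
      Gdisp al1 al2 al3 (- x) (- k s) = \prod_(j < 4) (x - om s j)) ->
  (* omega_4(k_s) = k_s *)
  (forall s : 'I_N, om s (inord 3) = k s) ->
  (* the integer powers in psi are well defined *)
  (forall (s : 'I_N) (j : 'I_4),
      [/\ p != om s j, q != om s j, a != om s j & b != om s j]) ->
  let p_b := Gdisp al1 al2 al3 (- p) (- b) / (p - b) in
  let q_b := Gdisp al1 al2 al3 (- q) (- b) / (q - b) in
  let a_b := Gdisp al1 al2 al3 (- a) (- b) / (a - b) in
  let f := casoratian rho om p q a b (@cols_f N) in
  let g := casoratian rho om p q a b (@cols_g N) in
  forall n m al be : int,
  ((p - a) * f (n + 1) m al be * f n m (al - 1) (be + 1)
        - (p - b) * f n m al be * f (n + 1) m (al - 1) (be + 1)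
        - (b - a) * f n m al (be + 1) * f (n + 1) m (al - 1) be = 0 /\
      (q - a) * f n (m + 1) al be * f n m (al - 1) (be + 1)
        - (q - b) * f n m al be * f n (m + 1) (al - 1) (be + 1)
        - (b - a) * f n m al (be + 1) * f n (m + 1) (al - 1) be = 0 /\
      f n m al be * (a * f (n + 1) m (al - 1) be + g (n + 1) m (al - 1) be)
        + (p - a) * f (n + 1) m al be * f n m (al - 1) be
        - (p * f n m al be + g n m al be) * f (n + 1) m (al - 1) be = 0 /\
      f n m al be * (a * f n (m + 1) (al - 1) be + g n (m + 1) (al - 1) be)
        + (q - a) * f n (m + 1) al be * f n m (al - 1) be
        - (q * f n m al be + g n m al be) * f n (m + 1) (al - 1) be = 0 /\
      f (n + 1) m al be * (p * f n m al (be + 1) + g n m al (be + 1))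
        - (p - b) * f n m al be * f (n + 1) m al (be + 1)
        - (b * f (n + 1) m al be + g (n + 1) m al be) * f n m al (be + 1) = 0 /\
      f n (m + 1) al be * (q * f n m al (be + 1) + g n m al (be + 1))
        - (q - b) * f n m al be * f n (m + 1) al (be + 1)
        - (b * f n (m + 1) al be + g n (m + 1) al be) * f n m al (be + 1) = 0 /\
      (p - b) * f (n + 1) m al (be + 1) * f n (m + 1) al be
        - (q - b) * f n (m + 1) al (be + 1) * f (n + 1) m al be
        - (p - q) * f (n + 1) (m + 1) al be * f n m al (be + 1) = 0 /\
    (a * f n m (al - 1) be + g n m (al - 1) be) * f (n + 1) (m + 1) al (be + 1)
        - f n m (al - 1) be * (g (n + 1) (m + 1) al (be + 1)
                                - b * f (n + 1) (m + 1) al (be + 1))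
        - p_b * f n (m + 1) al (be + 1) * f (n + 1) m (al - 1) be / ((p - q) * (p - a))
        + q_b * f (n + 1) m al (be + 1) * f n (m + 1) (al - 1) be / ((p - q) * (q - a))
        + (p + q - al3) * f n m (al - 1) be * f (n + 1) (m + 1) al (be + 1)
        - a_b / ((p - a) * (q - a)) * f n m al be * f (n + 1) (m + 1) (al - 1) (be + 1)
        = 0).
Proof.
case: N k om rho => [|N] // k om rho _ pq pa pb qa qb ab Gprod omk om_neq.
move=> p_b q_b a_b f g n m al be; rewrite /f /g {f g}.
(* Taking [al - 1] as base value makes the backward shift the unshifted state, so that only forward
   shifts occur. *)
have [al' ->] : exists al', al = al' + 1 by exists (al - 1); rewrite subrK.
rewrite addrK => {al}.
have uniq3 u v w : u != v -> u != w -> v != w -> uniq [:: - u; - v; - w : R[i]].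
  by move=> uv uw vw; rewrite /= !inE !eqr_opp negb_or uv uw vw.
pose T := casoratian_shift _ _ rho om p q a b n m _ be _ _ _ _ _ om_neq.
have t := (T al' false false false false (@cols_f _), T al' true false false false (@cols_f _),
  T al' false true false false (@cols_f _), T al' false false true false (@cols_f _),
  T al' false false false true (@cols_f _), T al' true false true false (@cols_f _),
  T al' false true true false (@cols_f _), T al' true false false true (@cols_f _),
  T al' false true false true (@cols_f _), T al' false false true true (@cols_f _),
  T al' true true false true (@cols_f _), T al' true false true true (@cols_f _),
  T al' false true true true (@cols_f _), T al' true true true true (@cols_f _),
  T al' false false false false (@cols_g _), T al' true false false false (@cols_g _),
  T al' false true false false (@cols_g _), T al' false false true false (@cols_g _),
  T al' true true true true (@cols_g _)).
(* Equations without the backward shift use the base value [al] itself. *)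
have t1 := (T (al' + 1) false false false false (@cols_f _), T (al' + 1) true false false false (@cols_f _),
  T (al' + 1) false true false false (@cols_f _), T (al' + 1) false false false true (@cols_f _),
  T (al' + 1) true true false false (@cols_f _), T (al' + 1) true false false true (@cols_f _),
  T (al' + 1) false true false true (@cols_f _), T (al' + 1) true false false false (@cols_g _),
  T (al' + 1) false true false false (@cols_g _), T (al' + 1) false false false true (@cols_g _)).
rewrite /= ?mul1r ?mulr1 in t; rewrite /= ?mul1r ?mulr1 in t1.
pose L := psifun rho om p q a b n m al' be; pose L1 := psifun rho om p q a b n m (al' + 1) be.
split; [|split; [|split; [|split; [|split; [|split; [|split]]]]]].
- rewrite !t; have := three_node_identity L _ _ _ (uniq3 _ _ _ pa pb ab).
  by rewrite -/L; move: (polydet _ _) => d e; rewrite -[RHS]oppr0 -e; ring.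
- rewrite !t; have := three_node_identity L _ _ _ (uniq3 _ _ _ qa qb ab).
  by rewrite -/L; move: (polydet _ _) => d e; rewrite -[RHS]oppr0 -e; ring.
- rewrite !t; have := one_node_identity L (- p) (- a).
  rewrite -/L; move: (polydet L (@cols_f _)) (polydet L (@cols_g _)) => d dg /eqP.
  by rewrite -subr_eq0 => /eqP e; rewrite -[RHS]e; ring.
- rewrite !t; have := one_node_identity L (- q) (- a).
  rewrite -/L; move: (polydet L (@cols_f _)) (polydet L (@cols_g _)) => d dg /eqP.
  by rewrite -subr_eq0 => /eqP e; rewrite -[RHS]e; ring.
- rewrite !t1; have := one_node_identity L1 (- p) (- b).
  rewrite -/L1; move: (polydet L1 (@cols_f _)) (polydet L1 (@cols_g _)) => d dg /eqP.
  by rewrite -subr_eq0 => /eqP e; rewrite -[RHS]oppr0 -e; ring.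
- rewrite !t1; have := one_node_identity L1 (- q) (- b).
  rewrite -/L1; move: (polydet L1 (@cols_f _)) (polydet L1 (@cols_g _)) => d dg /eqP.
  by rewrite -subr_eq0 => /eqP e; rewrite -[RHS]oppr0 -e; ring.
- rewrite !t1; have := three_node_identity L1 _ _ _ (uniq3 _ _ _ pq pb qb).
  by rewrite -/L1; move: (polydet _ _) => d e; rewrite -[RHS]e; ring.
rewrite !t.
(* [F] is G(y, -b) as a polynomial in [y]: it is monic of degree 4 with next coefficient [al3], the
   source of the term [p + q - al3]. *)
pose F : {poly R[i]} := Poly [:: Gdisp al1 al2 al3 0 (- b); al1; al2; al3; 1].
have FE x : F.[x] = Gdisp al1 al2 al3 x (- b).
  by rewrite horner_Poly /= /Gdisp; ring.
have Gom s j : Gdisp al1 al2 al3 (- om s j) (- k s) = 0.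
  by rewrite Gprod (bigD1 j) //= subrr mul0r.
have pqab : uniq [:: - p; - q; - a; - b].
  by rewrite /= !inE !eqr_opp !negb_or pq pa pb qa qb ab.
have := four_node_identity L _ _ _ _ F _ pqab (size_Poly _)
  (psifun_dispersion _ _ rho om p q a b n m al' be al1 al2 al3 k F FE Gom).
rewrite /= !FE !coef_Poly /= -/L /p_b /q_b /a_b {t1 t T p_b q_b a_b}.
move: (polydet L (@cols_f _)) (polydet L (@cols_g _)) => d dg e.
move: pq pa pb qa qb ab; rewrite -(subr_eq0 p q) -(subr_eq0 p a) -(subr_eq0 p b).
rewrite -(subr_eq0 q a) -(subr_eq0 q b) -(subr_eq0 a b) => pq pa pb qa qb ab.
(* The node [- b] contributes nothing; the other three yield the terms in [p_b], [q_b] and [a_b]. *)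
have Gbb : Gdisp al1 al2 al3 (- b) (- b) = 0 by rewrite /Gdisp; ring.
rewrite Gbb !mul0r addr0 in e.
move: e; move: (Gdisp _ _ _ _ _) => gp; move: (Gdisp _ _ _ _ _) => gq.
move: (Gdisp _ _ _ _ _) => ga /eqP; rewrite -subr_eq0 => /eqP e.
have oppB_neq0 (x y : R[i]) : (- x - - y != 0) = (x - y != 0).
  by rewrite -opprD oppr_eq0.
rewrite -[RHS]oppr0 -e; field.
rewrite !oppB_neq0 -(opprB p q) -(opprB p a) -(opprB q a) !oppr_eq0.
by rewrite pq pa pb qa qb ab.
Qed.
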